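(* Let $\delta$ be a constant with $\mathrm{e}<\delta\le\sum_{j=1}^{5}(5/6)^j$. There is a constant $C>0$ (depending only on $\delta$) such that for every $k\ge 2$, when $k$ nodes of a one-hop radio network without collision detection all receive a message at time $0$ and each runs protocol One-fail Adaptive with parameter $\delta$, all $k$ messages are delivered within $2(\delta+1)k+C\log^2 k$ communication steps with probability at least $1-2/(1+k)$.
   Context: Model (one-hop Radio Network without collision detection): time is divided into synchronous communication steps $1,2,\dots$. A node holding an undelivered message is active. In each step each active node may transmit. If exactly one node transmits, the transmission is successful: its message is delivered, all other nodes receive it, and the transmitting node becomes idle, never transmitting again. If zero or at least two nodes transmit, nobody receives anything, and nodes cannot distinguish these two cases. Nodes have no prior information (not the number $k$ of active nodes, nor the total number of nodes, nor labels). Static $k$-selection: $k$ nodes are activated simultaneously; the problem is solved when all $k$ messages have been delivered. $\log$ denotes $\log_2$. Protocol One-fail Adaptive with parameter $\delta$, run by each active node: initially set $\widetilde\kappa\leftarrow\delta+1$ and $\sigma\leftarrow0$. In each step $s=1,2,\dots$: if $s$ is even (a BT-step), transmit with probability $1/(1+\log(\sigma+1))$; if $s$ is odd (an AT-step), transmit with probability $1/\widetilde\kappa$ and then set $\widetilde\kappa\leftarrow\widetilde\kappa+1$. Whenever the node receives a message from another node in step $s$: set $\sigma\leftarrow\sigma+1$, and if $s$ is even set $\widetilde\kappa\leftarrow\max\{\widetilde\kappa-\delta,\delta+1\}$, while if $s$ is odd set $\widetilde\kappa\leftarrow\max\{\widetilde\kappa-\delta-1,\delta+1\}$. The node stops as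 soon as its own message is delivered. *)

(* Defs.v *)
From Stdlib Require Import Reals List Lra Lia.
Import ListNotations.
Open Scope R_scope.

Definition log2 (x : R) : R := ln x / ln 2.

(* Local state of an active node running One-fail Adaptive:
   kap = the estimate \widetilde\kappa, sig = the counter \sigma. *)
Record nstate := mkN { kap : R; sig : nat }.

Definition init_state (delta : R) : nstate := mkN (delta + 1) 0.

(* Steps are numbered 1,2,...; even steps are BT-steps, odd are AT-steps. *)
Definition tprob (s : nat) (x : nstate) : R :=
  if Nat.even s then / (1 + log2 (INR (sig x) + 1)) else / kap x.

(* State after the (possible) transmission of step s, before reception:
   in an AT-step \widetilde\kappa is incremented. *)
Definition post (s : nat) (x : nstate) : nstate :=
  if Nat.even s then x else mkN (kap x + 1) (sig x).

Definition recv (delta : R) (s : nat) (x : nstate) : nstate :=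
  let y := post s x in
  mkN (if Nat.even s then Rmax (kap y - delta) (delta + 1)
       else Rmax (kap y - delta - 1) (delta + 1))
      (S (sig y)).

Fixpoint choices (m : nat) : list (list bool) :=
  match m with
  | O => [ [] ]
  | S m' => flat_map (fun l => [true :: l; false :: l]) (choices m')
  end.

Fixpoint cprob (s : nat) (c : list nstate) (bs : list bool) : R :=
  match c, bs with
  | x :: c', b :: bs' =>
      (if b then tprob s x else 1 - tprob s x) * cprob s c' bs'
  | _, _ => 1
  end.

Definition ntrans (bs : list bool) : nat := count_occ Bool.bool_dec bs true.

(* Configuration after step s given the pattern bs: on success (exactly one
   transmitter) the transmitter becomes idle (is removed) and all others
   receive; otherwise nobody receives anything. *)
Definition next (delta : R) (s : nat) (c : list nstate) (bs : list bool)
  : list nstate :=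
  if Nat.eqb (ntrans bs) 1 then
    map (fun p => recv delta s (fst p))
        (filter (fun p => negb (snd p)) (combine c bs))
  else map (post s) c.

Fixpoint sumR (l : list R) : R :=
  match l with [] => 0 | x :: l' => x + sumR l' end.

Fixpoint pdone (delta : R) (T s : nat) (c : list nstate) : R :=
  match c with
  | [] => 1
  | _ :: _ =>
    match T with
    | O => 0
    | S T' =>
        sumR (map (fun bs => cprob s c bs * pdone delta T' (S s) (next delta s c bs))
                  (choices (length c)))
    end
  end.

Definition success_prob (delta : R) (k T : nat) : R :=
  pdone delta T 1 (repeat (init_state delta) k).

(* Main.v *)
Require Import Defs.
From Stdlib Require Import Reals List.
From Stdlib Require Import ZArith Lra Lia.
Open Scope R_scope.

(** With [m] active nodes, an AT-step succeeds with probability about [x exp (-x)], [x = m / kap].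
    For [delta > e] the quantity [kap - 4/5 m] has negative drift whenever [kap] lies between
    [3/4 m] and [4/5 m], so while [m] exceeds a multiple of [log k] an exponential potential keeps
    [kap < 4/5 m] with high probability. As [kap + (delta + 1) sig] gains at least 1 in every
    AT-step, [kap < 4/5 m] forces the elapsed time to be at most [2 (delta + 1) k]. Once
    [m = O(log k)], each BT-step succeeds with probability of order [1 / log k], so [O(log^2 k)]
    further steps suffice. For the finitely many [k] that never exceed the threshold, the only
    obstacle is the first delivery, as a BT-step with [sig = 0] always collides; the AT-steps
    provide it because the harmonic series diverges. *)

(** * Reduction to a chain on (number of active nodes, common state) *)

(** Exactly one of [S n] nodes transmits; the index [n] counts those that must stay silent. *)
Definition succ_prob (p : R) (n : nat) : R := INR (S n) * p * (1 - p) ^ n.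

Lemma succ_prob_nonneg p n : 0 <= p <= 1 -> 0 <= succ_prob p n.
Proof.
intros Hp; unfold succ_prob.
assert (0 <= (1 - p) ^ n) by (apply pow_le; lra).
pose proof (pos_INR (S n)). 
apply Rmult_le_pos; [apply Rmult_le_pos; lra | lra].
Qed.

(** The induction needs the stronger fact that one transmitter and no transmitter, being disjoint
    events, have total probability at most 1. *)
Lemma succ_prob_le1 p n : 0 <= p <= 1 -> succ_prob p n <= 1.
Proof.
intros Hp.
assert (succ_prob p n + (1 - p) ^ S n <= 1) as H.
{ induction n as [|n IH].
  - unfold succ_prob; simpl; lra.
  - pose proof (succ_prob_nonneg p n Hp) as H0.
    replace (succ_prob p (S n) + (1 - p) ^ S (S n))
      with ((1 - p) * succ_prob p n + (1 - p) ^ S n)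
      by (unfold succ_prob; rewrite !S_INR; simpl; ring).
    nra. }
assert (0 <= (1 - p) ^ S n) by (apply pow_le; lra).
lra.
Qed.

Lemma choices_length m bs : In bs (choices m) -> length bs = m.
Proof.
revert bs; induction m as [|m IH]; simpl; intros bs H.
- destruct H as [<-|[]]; reflexivity.
- apply in_flat_map in H as [l [Hl [<-|[<-|[]]]]]; simpl; f_equal; auto.
Qed.

(** Conditioning on the first node; [h] stands for any quantity that depends on the pattern only
    through the number of transmitters. *)
Lemma sumR_choices_S s x m (h : nat -> R) :
  sumR (map (fun bs => cprob s (repeat x (S m)) bs * h (ntrans bs)) (choices (S m)))
  = tprob s x * sumR (map (fun bs => cprob s (repeat x m) bs * h (S (ntrans bs))) (choices m))
    + (1 - tprob s x) * sumR (map (fun bs => cprob s (repeat x m) bs * h (ntrans bs)) (choices m)).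
Proof.
cbn [choices repeat]; induction (choices m) as [|l ls IH]; [simpl; ring|].
cbn [flat_map app map sumR]; rewrite IH; cbn [cprob]; unfold ntrans; simpl; ring.
Qed.

Lemma sumR_choices_const s x m b :
  sumR (map (fun bs => cprob s (repeat x m) bs * b) (choices m)) = b.
Proof.
induction m as [|m IH]; [simpl; ring|].
rewrite (sumR_choices_S s x m (fun _ => b)), IH; ring.
Qed.

Lemma sumR_choices_eq0 s x m a b :
  sumR (map (fun bs => cprob s (repeat x m) bs * (if Nat.eqb (ntrans bs) 0 then a else b)) (choices m))
  = (1 - tprob s x) ^ m * a + (1 - (1 - tprob s x) ^ m) * b.
Proof.
induction m as [|m IH]; [simpl; ring|].
rewrite (sumR_choices_S s x m (fun n => if Nat.eqb n 0 then a else b)), IH.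
simpl Nat.eqb; cbv iota; rewrite sumR_choices_const; simpl; ring.
Qed.

Lemma sumR_choices_eq1 s x m a b :
  sumR (map (fun bs => cprob s (repeat x (S m)) bs
    * (if Nat.eqb (ntrans bs) 1 then a else b)) (choices (S m)))
  = succ_prob (tprob s x) m * a + (1 - succ_prob (tprob s x) m) * b.
Proof.
rewrite (sumR_choices_S s x m (fun n => if Nat.eqb n 1 then a else b)).
induction m as [|m IH]; [unfold succ_prob; simpl; ring|].
rewrite (sumR_choices_S s x m (fun n => if Nat.eqb n 1 then a else b)), IH.
pose proof (sumR_choices_eq0 s x (S m) a b) as H0; simpl Nat.eqb in H0 |- *.
cbn [Nat.eqb]. rewrite H0.
unfold succ_prob; rewrite !S_INR; simpl; ring.
Qed.

Lemma ntrans_le_length bs : (ntrans bs <= length bs)%nat.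
Proof. apply count_occ_bound. Qed.

Lemma filter_receivers {A} (g : nstate -> A) x bs :
  map (fun p => g (fst p)) (filter (fun p => negb (snd p)) (combine (repeat x (length bs)) bs))
  = repeat (g x) (length bs - ntrans bs).
Proof.
induction bs as [|b bs IH]; [reflexivity|].
pose proof (ntrans_le_length bs).
destruct b; cbn [length repeat combine filter snd fst negb map]; rewrite IH;
  [reflexivity|].
change (ntrans (false :: bs)) with (ntrans bs).
rewrite Nat.sub_succ_l by lia; reflexivity.
Qed.

Lemma next_repeat delta s x bs :
  next delta s (repeat x (length bs)) bs
  = if Nat.eqb (ntrans bs) 1 then repeat (recv delta s x) (length bs - 1)
    else repeat (post s x) (length bs).
Proof.
unfold next; destruct (Nat.eqb_spec (ntrans bs) 1) as [E|_].
- rewrite filter_receivers, E; reflexivity.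
- apply map_repeat.
Qed.

(* All active nodes hear the same messages, hence share one state [x]; a configuration is
   determined by [x] and the number [m] of active nodes. *)
Definition fail (delta : R) (T s m : nat) (x : nstate) : R :=
  1 - pdone delta T s (repeat x m).

Lemma fail_done delta T s x : fail delta T s 0 x = 0.
Proof. unfold fail; destruct T; simpl; ring. Qed.

(** The next configuration depends on the pattern only through whether exactly one node transmits,
    so the sum over all patterns collapses to two terms. *)
Lemma fail_step delta T s n x :
  fail delta (S T) s (S n) x
  = succ_prob (tprob s x) n * fail delta T (S s) n (recv delta s x)
    + (1 - succ_prob (tprob s x) n) * fail delta T (S s) (S n) (post s x).
Proof.
unfold fail.
enough (pdone delta (S T) s (repeat x (S n))
  = succ_prob (tprob s x) n * pdone delta T (S s) (repeat (recv delta s x) n)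
    + (1 - succ_prob (tprob s x) n) * pdone delta T (S s) (repeat (post s x) (S n))) as ->
  by ring.
rewrite <- sumR_choices_eq1.
change (pdone delta (S T) s (repeat x (S n))) with
  (sumR (map (fun bs => cprob s (repeat x (S n)) bs
     * pdone delta T (S s) (next delta s (repeat x (S n)) bs))
     (choices (length (repeat x (S n)))))).
rewrite repeat_length; f_equal; apply map_ext_in; intros bs Hbs.
apply choices_length in Hbs; rewrite <- Hbs at 2; rewrite next_repeat, Hbs.
replace (S n - 1)%nat with n by lia.
destruct (Nat.eqb (ntrans bs) 1); reflexivity.
Qed.

(** * BT-steps and the final phase *)

Lemma ln_le x y : 0 < x -> x <= y -> ln x <= ln y.
Proof. intros Hx [H| <-]; [left; apply ln_increasing; lra | lra]. Qed.

Lemma log2_nonneg x : 1 <= x -> 0 <= log2 x.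
Proof.
intros H; unfold log2; pose proof ln_lt_2 as L2.
assert (0 <= ln x) by (rewrite <- ln_1; apply ln_le; lra).
apply Rmult_le_pos; [lra|]; left; apply Rinv_0_lt_compat; lra.
Qed.

Lemma log2_le x y : 0 < x -> x <= y -> log2 x <= log2 y.
Proof.
intros Hx H; unfold log2; pose proof ln_lt_2; pose proof (ln_le x y Hx H).
apply Rmult_le_compat_r; [left; apply Rinv_0_lt_compat; lra | lra].
Qed.

Lemma inv_bounds x : 1 <= x -> 0 < / x <= 1.
Proof.
intros H; pose proof (Rinv_0_lt_compat x ltac:(lra)).
pose proof (Rinv_l x ltac:(lra)); split; nra.
Qed.

Lemma bt_prob_bounds n : 0 < / (1 + log2 (INR n + 1)) <= 1.
Proof.
pose proof (pos_INR n); pose proof (log2_nonneg (INR n + 1)).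
apply inv_bounds; lra.
Qed.

Lemma tprob_bounds delta s x : 0 < delta -> delta + 1 <= kap x -> 0 <= tprob s x <= 1.
Proof.
intros Hd Hx; unfold tprob; destruct (Nat.even s).
- pose proof (bt_prob_bounds (sig x)); lra.
- pose proof (inv_bounds (kap x)); lra.
Qed.

Lemma kap_recv_ge delta s x : delta + 1 <= kap (recv delta s x).
Proof. unfold recv; simpl; destruct (Nat.even s); apply Rmax_r. Qed.

Lemma kap_post_ge delta s x : delta + 1 <= kap x -> delta + 1 <= kap (post s x).
Proof. unfold post; destruct (Nat.even s); simpl; lra. Qed.

Lemma sig_recv delta s x : sig (recv delta s x) = S (sig x).
Proof. unfold recv, post; destruct (Nat.even s); reflexivity. Qed.

Lemma sig_post s x : sig (post s x) = sig x.
Proof. unfold post; destruct (Nat.even s); reflexivity. Qed.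

Lemma fail_le1 delta T s m x : 0 < delta -> delta + 1 <= kap x -> fail delta T s m x <= 1.
Proof.
intros Hd; revert s m x; induction T as [|T IH]; intros s [|n] x Hx;
  rewrite ?fail_done; try lra.
- unfold fail; simpl; lra.
- rewrite fail_step.
  pose proof (tprob_bounds delta s x Hd Hx) as Hp.
  pose proof (succ_prob_nonneg _ n Hp); pose proof (succ_prob_le1 _ n Hp).
  pose proof (IH (S s) n _ (kap_recv_ge delta s x)).
  pose proof (IH (S s) (S n) _ (kap_post_ge delta s x Hx)).
  nra.
Qed.

(** A delivery at least halves [exp (INR m)], so each BT-step shrinks its expectation by the factor
    [1 - qs / 2] or more, and AT-steps do not increase it. The exponent counts the even steps among
    the next [T]. *)
Lemma bt_phase delta k m0 qs :
  0 < delta -> 0 <= qs <= 1 ->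
  (forall n x, (S n < m0)%nat -> (S n + sig x = k)%nat ->
     qs <= succ_prob (/ (1 + log2 (INR (sig x) + 1))) n) ->
  forall T s m x, (m < m0)%nat -> (m + sig x = k)%nat -> delta + 1 <= kap x ->
  fail delta T s m x
  <= exp (INR m) * (1 - qs / 2) ^ (Nat.div2 (if Nat.even s then S T else T)).
Proof.
intros Hd Hq Hbt T; induction T as [|T IH]; intros s m x Hm Hk Hx.
- replace (Nat.div2 (if Nat.even s then 1 else 0)) with 0%nat
    by (destruct (Nat.even s); reflexivity).
  pose proof (fail_le1 delta 0 s m x Hd Hx).
  pose proof (exp_ineq1_le (INR m)); pose proof (pos_INR m); simpl; lra.
- destruct m as [|n].
  { rewrite fail_done; apply Rmult_le_pos; [left; apply exp_pos | apply pow_le; lra]. }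
  rewrite fail_step.
  pose proof (tprob_bounds delta s x Hd Hx) as Hp.
  pose proof (succ_prob_nonneg _ n Hp) as Q0; pose proof (succ_prob_le1 _ n Hp) as Q1.
  assert (IH1 := IH (S s) n _ ltac:(lia) ltac:(rewrite (sig_recv delta s x); lia) (kap_recv_ge delta s x)).
  assert (IH2 := IH (S s) (S n) _ Hm ltac:(rewrite (sig_post s x); lia) (kap_post_ge delta s x Hx)).
  pose proof (Hbt n x Hm Hk) as Hs.
  unfold tprob in *.
  rewrite Nat.even_succ, <- Nat.negb_even in IH1, IH2.
  assert (exp (INR n) <= exp (INR (S n)) / 2) as He.
  { rewrite S_INR, exp_plus; pose proof (exp_ineq1_le 1); pose proof (exp_pos (INR n)); nra. }
  destruct (Nat.even s); simpl negb in *; cbv iota in *; simpl Nat.div2 in *.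
  + set (w := (1 - qs / 2) ^ Nat.div2 T) in *.
    change ((1 - qs / 2) ^ S (Nat.div2 T)) with ((1 - qs / 2) * w).
    assert (0 <= w) by (apply pow_le; lra).
    set (q := succ_prob _ n) in *.
    assert (exp (INR n) * w <= exp (INR (S n)) * w / 2) by nra.
    assert (0 <= exp (INR (S n)) * w) by (apply Rmult_le_pos; [left; apply exp_pos | lra]).
    set (z := exp (INR (S n)) * w) in *.
    apply Rle_trans with (q * (z / 2) + (1 - q) * z); [apply Rplus_le_compat; apply Rmult_le_compat_l; lra|].
    replace (exp (INR (S n)) * ((1 - qs / 2) * w)) with ((1 - qs / 2) * z) by (unfold z; ring).
    nra.
  + set (w := (1 - qs / 2) ^ _) in *.
    assert (0 <= w) by (apply pow_le; lra).
    set (q := succ_prob _ n) in *.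
    pose proof (exp_pos (INR (S n))).
    assert (exp (INR n) * w <= exp (INR (S n)) * w) by nra.
    set (z := exp (INR (S n)) * w) in *.
    apply Rle_trans with (q * z + (1 - q) * z); [apply Rplus_le_compat; apply Rmult_le_compat_l; lra | lra].
Qed.

(** * Supermartingale bound for the first phase *)

(* Every AT-step increases [kap + (delta + 1) * sig] by at least 1 and no BT-step decreases it,
   so that a small [kap] bounds the elapsed time. *)
Definition clock (delta : R) (s : nat) (x : nstate) : Prop :=
  INR s + (if Nat.even s then 1 else 0) <= 2 * (kap x + (delta + 1) * INR (sig x)).

(** The parity term lets the left side grow by 2 in an AT-step and stay put in a BT-step. On the
    right, the loss in [kap] is outweighed by the gain [delta + 1] through [sig], and truncation
    only raises [kap]. *)
Lemma clock_recv delta s x : clock delta s x -> clock delta (S s) (recv delta s x).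
Proof.
unfold clock; rewrite sig_recv, !S_INR, Nat.even_succ, <- Nat.negb_even.
unfold recv, post; destruct (Nat.even s); simpl.
- pose proof (Rmax_l (kap x - delta) (delta + 1)); lra.
- pose proof (Rmax_l (kap x + 1 - delta - 1) (delta + 1)); lra.
Qed.

Lemma clock_post delta s x : clock delta s x -> clock delta (S s) (post s x).
Proof.
unfold clock; rewrite sig_post, S_INR, Nat.even_succ, <- Nat.negb_even.
unfold post; destruct (Nat.even s); simpl; lra.
Qed.

(* [V] bounds the probability of leaving the first phase ([m0 <= m]) too late or not at all,
   and [E] the probability of failing after having left it in time. *)
Lemma potential_bound delta k m0 Ttot S0 E (V : nat -> nat -> R -> R) :
  0 < delta -> (0 < m0)%nat -> 0 <= E -> S0 < INR Ttot + 1 ->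
  (forall s m y, 0 <= V s m y) ->
  (forall T s m x, (m < m0)%nat -> (m + sig x = k)%nat -> delta + 1 <= kap x ->
     (T + s = Ttot + 1)%nat -> INR s <= S0 + 1 -> fail delta T s m x <= E) ->
  (forall s n x, (m0 <= S n)%nat -> (S n + sig x = k)%nat -> delta + 1 <= kap x ->
     clock delta s x ->
     1 <= V s (S n) (kap x) \/
     INR s <= S0 /\
     succ_prob (tprob s x) n * V (S s) n (kap (recv delta s x))
     + (1 - succ_prob (tprob s x) n) * V (S s) (S n) (kap (post s x)) <= V s (S n) (kap x)) ->
  forall T s m x, (m0 <= m)%nat -> (m + sig x = k)%nat -> delta + 1 <= kap x ->
    clock delta s x -> (T + s = Ttot + 1)%nat ->
    fail delta T s m x <= V s m (kap x) + E.
Proof.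
intros Hd Hm0 HE HS0 HV Hlow Hstep T; induction T as [|T IH];
  intros s [|n] x Hm Hk Hx Hc HT; try lia;
  destruct (Hstep s n x Hm Hk Hx Hc) as [H1 | [Hs H1]];
  try (pose proof (fail_le1 delta 0 s (S n) x Hd Hx); lra);
  try (pose proof (fail_le1 delta (S T) s (S n) x Hd Hx); lra).
(* No steps are left: [s = Ttot + 1] contradicts [INR s <= S0]. *)
- simpl in HT; subst s; rewrite plus_INR in Hs; simpl in Hs; lra.
- rewrite fail_step.
  pose proof (tprob_bounds delta s x Hd Hx) as Hp.
  pose proof (succ_prob_nonneg _ n Hp) as Q0; pose proof (succ_prob_le1 _ n Hp) as Q1.
  assert (IH2 := IH (S s) (S n) _ Hm ltac:(rewrite (sig_post s x); lia) (kap_post_ge delta s x Hx)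
     (clock_post _ _ _ Hc) ltac:(lia)).
  assert (fail delta T (S s) n (recv delta s x) <= V (S s) n (kap (recv delta s x)) + E) as IH1.
  (* A delivery that leaves fewer than [m0] nodes ends the first phase; [E] covers the rest. *)
  { destruct (Nat.lt_ge_cases n m0) as [Hn|Hn].
    - pose proof (HV (S s) n (kap (recv delta s x))).
      enough (fail delta T (S s) n (recv delta s x) <= E) by lra.
      apply Hlow; auto.
      + rewrite sig_recv; lia.
      + apply kap_recv_ge.
      + lia.
      + rewrite S_INR; lra.
    - apply IH; auto.
      + rewrite sig_recv; lia.
      + apply kap_recv_ge.
      + apply clock_recv; auto.
      + lia. }
  set (q := succ_prob _ n) in *.
  pose proof (Rmult_le_compat_l q _ _ Q0 IH1).
  pose proof (Rmult_le_compat_l (1 - q) _ _ ltac:(lra) IH2).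
  lra.
Qed.

(** * Numerical estimates for AT-steps *)

Lemma exp_sqr_ge r s y n : r <= exp (y / 2 ^ S n) -> 0 <= r -> s <= r * r -> s <= exp (y / 2 ^ n).
Proof.
intros H H0 Hs; assert (2 ^ n <> 0) by (apply pow_nonzero; lra).
replace (y / 2 ^ n) with (y / 2 ^ S n + y / 2 ^ S n) by (simpl; field; auto).
rewrite exp_plus; nra.
Qed.

(* Repeated squaring of [1 + y / 2^n <= exp (y / 2^n)], rounding down at each step. *)
Lemma exp_1_ge : 27/10 <= exp 1.
Proof.
assert (129/128 <= exp (1 / 2 ^ 7)) as H by (pose proof (exp_ineq1_le (1 / 2 ^ 7)); lra).
apply (exp_sqr_ge _ (507843/500000)) in H; [|lra|lra].
apply (exp_sqr_ge _ (515809/500000)) in H; [|lra|lra].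
apply (exp_sqr_ge _ (2660589/2500000)) in H; [|lra|lra].
apply (exp_sqr_ge _ (5662987/5000000)) in H; [|lra|lra].
apply (exp_sqr_ge _ (1603471/1250000)) in H; [|lra|lra].
apply (exp_sqr_ge _ (16455163/10000000)) in H; [|lra|lra].
apply (exp_sqr_ge _ (13538619/5000000)) in H; [|lra|lra].
simpl in H; unfold Rdiv in H; rewrite Rinv_1, Rmult_1_r in H; lra.
Qed.

(** The exponent lies just beyond [-(4/3) - 1/200], the worst one in [at_succ_prob_ge]. *)
Lemma exp_m134_ge : 261/1000 <= exp (-(134/100)).
Proof.
assert (4993457/5000000 <= exp (-(134/100) / 2 ^ 10)) as H by (pose proof (exp_ineq1_le (-(134/100) / 2 ^ 10)); lra).
apply (exp_sqr_ge _ (99738451/100000000)) in H; [|lra|lra].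
apply (exp_sqr_ge _ (49738793/50000000)) in H; [|lra|lra].
apply (exp_sqr_ge _ (98957901/100000000)) in H; [|lra|lra].
apply (exp_sqr_ge _ (97926661/100000000)) in H; [|lra|lra].
apply (exp_sqr_ge _ (95896309/100000000)) in H; [|lra|lra].
apply (exp_sqr_ge _ (4598051/5000000)) in H; [|lra|lra].
apply (exp_sqr_ge _ (84568291/100000000)) in H; [|lra|lra].
apply (exp_sqr_ge _ (35758979/50000000)) in H; [|lra|lra].
apply (exp_sqr_ge _ (51148183/100000000)) in H; [|lra|lra].
apply (exp_sqr_ge _ (13080683/50000000)) in H; [|lra|lra].
simpl in H; unfold Rdiv in H; rewrite Rinv_1, Rmult_1_r in H; lra.
Qed.

(** Inverse of [1 + u <= exp u] at [u = / (y - 1)]. *)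
Lemma one_sub_inv_ge y : 1 < y -> exp (- / (y - 1)) <= 1 - / y.
Proof.
intros H; rewrite exp_Ropp.
assert (0 < / (y - 1)) by (apply Rinv_0_lt_compat; lra).
apply Rle_trans with (/ (1 + / (y - 1))).
- apply Rinv_le_contravar; [lra | apply exp_ineq1_le].
- right; field; lra.
Qed.

Lemma exp_INR_mult n y : exp (INR n * y) = exp y ^ n.
Proof.
induction n as [|n IH]; [simpl; rewrite Rmult_0_l; apply exp_0|].
rewrite S_INR, Rmult_plus_distr_r, exp_plus, IH, Rmult_1_l; simpl; ring.
Qed.

Lemma exp_le_pow y r n : exp y <= r -> exp (INR n * y) <= r ^ n.
Proof. intros H; rewrite exp_INR_mult; pose proof (exp_pos y); apply pow_incr; lra. Qed.

Lemma exp_le x y : x <= y -> exp x <= exp y.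
Proof. intros [H| ->]; [left; apply exp_increasing; auto | lra]. Qed.

(** For [x = INR (S n) / y] the probability is about [x * exp (- x)], which decreases on [5/4, 4/3]
    to about 0.351; [100 <= y] keeps the error in the exponent below 1/200. *)
Lemma at_succ_prob_ge n y :
  100 <= y -> 3/4 * INR (S n) <= y <= 4/5 * INR (S n) ->
  348/1000 <= succ_prob (/ y) n.
Proof.
intros Hy Hw; unfold succ_prob.
pose proof (exp_le_pow _ _ n (one_sub_inv_ge y ltac:(lra))) as Hn.
set (x := INR (S n) * / y).
assert (INR (S n) = x * y) as Hx by (unfold x; field; lra).
assert (5/4 <= x <= 4/3) as Hx1 by (rewrite Hx in Hw; split; nra).
assert (- (4/3) + (4/3 - x) - 1/200 <= INR n * - / (y - 1)) as Hexp.
{ apply Rmult_le_reg_r with (y - 1); [lra|].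
  replace (INR n * - / (y - 1) * (y - 1)) with (- INR n) by (field; lra).
  rewrite S_INR in Hx; replace (INR n) with (x * y - 1) by lra; nra. }
(* Linearising [exp (- x)] at 4/3 leaves a quadratic in [x], smallest at [x = 4/3], where it equals
   348/1000. *)
assert (261/1000 * (1 + (4/3 - x)) <= (1 - / y) ^ n) as Hp.
{ eapply Rle_trans; [|exact Hn]; eapply Rle_trans; [|apply exp_le, Hexp].
  apply Rle_trans with (exp (-(134/100)) * exp (4/3 - x)).
  - pose proof exp_m134_ge; pose proof (exp_ineq1_le (4/3 - x)).
    apply Rmult_le_compat; lra.
  - rewrite <- exp_plus; apply exp_le; lra. }
apply Rle_trans with (x * (261/1000 * (1 + (4/3 - x)))); [nra|].
apply Rmult_le_compat_l; lra.
Qed.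

(* Rate of the exponential potential; any small enough positive constant would do. *)
Definition rate : R := 1/1000.

(** To first order in [rate] the left side is [1 + rate * (1 - q * (1 + b))], and [q * (1 + b)] is
    at least 0.348 * 2.9 = 1.0092. The bound 19/10 is 27/10 - 4/5, the fall of [kap - 4/5 m] at a
    delivery when [delta = 27/10]. *)
Lemma exp_drift q b :
  348/1000 <= q <= 1 -> 19/10 <= b ->
  q * exp (rate * - b) + (1 - q) * exp rate <= 1.
Proof.
intros Hq Hb; unfold rate.
assert (exp (1/1000) <= 1001002/1000000) as H1.
{ pose proof (exp_ineq1_le (-(1/1000))) as H; rewrite exp_Ropp in H.
  pose proof (exp_pos (1/1000)); apply (Rmult_le_compat_r (exp (1/1000))) in H; [|lra].
  rewrite Rinv_l in H; lra. }
assert (exp (1/1000 * - b) <= 998104/1000000) as H2.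
{ apply Rle_trans with (exp (-(19/10000))); [apply exp_le; lra|].
  rewrite exp_Ropp; pose proof (exp_ineq1_le (19/10000)).
  apply Rle_trans with (/ (1 + 19/10000)); [apply Rinv_le_contravar; lra | lra]. }
nra.
Qed.

Lemma kap_recv_le delta s x : 0 < delta -> delta + 1 <= kap x -> kap (recv delta s x) <= kap x + 1.
Proof.
intros Hd Hx; unfold recv, post; destruct (Nat.even s); simpl; apply Rmax_lub; lra.
Qed.

Lemma kap_post_le s x : kap (post s x) <= kap x + 1.
Proof. unfold post; destruct (Nat.even s); simpl; lra. Qed.

(** For [kap >= 3/4 m] the exponential does not grow in expectation. Otherwise [kap - 4/5 m] is
    below [- m / 20] and rises by at most 1 + 4/5 < 2 in one step, which the additive term
    absorbs. *)
Lemma potential_drift delta s n x m0 :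
  27/10 <= delta <= 3 -> delta + 1 <= kap x -> 140 <= INR m0 -> (m0 <= S n)%nat ->
  kap x <= 4/5 * INR (S n) ->
  succ_prob (tprob s x) n * exp (rate * (kap (recv delta s x) - 4/5 * INR n))
  + (1 - succ_prob (tprob s x) n) * exp (rate * (kap (post s x) - 4/5 * INR (S n)))
  <= exp (rate * (kap x - 4/5 * INR (S n))) + exp (rate * (2 - INR m0 / 20)).
Proof.
intros Hd Hx Hm Hn Hk.
pose proof (tprob_bounds delta s x ltac:(lra) Hx) as Hp.
pose proof (succ_prob_nonneg _ n Hp) as Q0; pose proof (succ_prob_le1 _ n Hp) as Q1.
apply le_INR in Hn.
pose proof (S_INR n) as HS.
destruct (Rle_lt_dec (3/4 * INR (S n)) (kap x)) as [Hw|Hw].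
- apply Rle_trans with (exp (rate * (kap x - 4/5 * INR (S n))) + 0);
    [rewrite Rplus_0_r | apply Rplus_le_compat_l; left; apply exp_pos].
  set (Y := kap x - 4/5 * INR (S n)).
  (* Here [kap] is at least 3/4 * 140 = 105, so the truncation at [delta + 1] is inactive. *)
  assert (kap (recv delta s x) = kap x - delta) as Hr.
  { unfold recv, post; destruct (Nat.even s); simpl; rewrite Rmax_left; lra. }
  assert (kap (recv delta s x) - 4/5 * INR n = Y + - (delta - 4/5)) as -> by (unfold Y; lra).
  unfold tprob, post in *; destruct (Nat.even s); simpl kap.
  + fold Y; set (q := succ_prob _ n) in *.
    assert (exp (rate * (Y + - (delta - 4/5))) <= exp (rate * Y))
      by (apply exp_le; unfold rate; lra).
    pose proof (exp_pos (rate * Y)); nra.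
  + replace (kap x + 1 - 4/5 * INR (S n)) with (Y + 1) by (unfold Y; ring).
    rewrite !Rmult_plus_distr_l, !exp_plus, Rmult_1_r.
    pose proof (exp_drift (succ_prob (/ kap x) n) (delta - 4/5)
       (conj (at_succ_prob_ge n (kap x) ltac:(lra) ltac:(lra)) Q1) ltac:(lra)).
    pose proof (exp_pos (rate * Y)); nra.
- pose proof (kap_recv_le delta s x ltac:(lra) Hx); pose proof (kap_post_le s x).
  set (b := exp (rate * (2 - INR m0 / 20))).
  assert (exp (rate * (kap (recv delta s x) - 4/5 * INR n)) <= b)
    by (apply exp_le; unfold rate; lra).
  assert (exp (rate * (kap (post s x) - 4/5 * INR (S n))) <= b)
    by (apply exp_le; unfold rate; lra).
  set (q := succ_prob _ n) in *.
  pose proof (exp_pos (rate * (kap x - 4/5 * INR (S n)))).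
  apply Rle_trans with (q * b + (1 - q) * b); [apply Rplus_le_compat; apply Rmult_le_compat_l; lra | lra].
Qed.

(** * Conclusion *)

Lemma log2_ge1 x : 2 <= x -> 1 <= log2 x.
Proof.
intros H; replace 1 with (log2 2); [apply log2_le; lra|].
unfold log2; field; pose proof ln_lt_2; lra.
Qed.

Lemma log2_half x : 0 < x -> log2 (x / 2) = log2 x - 1.
Proof.
intros H; unfold log2; pose proof ln_lt_2; unfold Rdiv at 2; rewrite ln_mult, ln_Rinv by lra.
field; lra.
Qed.

Lemma ln_le_log2 x : 1 <= x -> ln x <= log2 x.
Proof.
intros H; unfold log2; pose proof ln_lt_2.
assert (0 <= ln x) by (rewrite <- ln_1; apply ln_le; lra).
assert (ln 2 <= 1).
{ rewrite <- (ln_exp 1); left; apply ln_increasing; [lra|]; pose proof exp_1_ge; lra. }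
assert (1 <= / ln 2) by (rewrite <- Rinv_1; apply Rinv_le_contravar; lra).
unfold Rdiv; nra.
Qed.

(** With [r = sqrt k], [ln k = 2 ln r <= 2 r] gives [log2 k <= 4 r], and [4 a r + b <= r * r] once
    [r >= 4 a + b + 1]. *)
Lemma log2_sublinear a b : 0 < a -> 0 < b ->
  exists K : nat, forall k, (K <= k)%nat -> a * log2 (INR k) + b <= INR k.
Proof.
intros Ha Hb; destruct (INR_unbounded ((4 * a + b + 1) * (4 * a + b + 1))) as [K HK].
exists K; intros k Hk; apply le_INR in Hk.
assert (1 < INR k) by nra.
set (r := sqrt (INR k)).
assert (r * r = INR k) as Hr by (apply sqrt_sqrt; lra).
assert (0 <= r) by apply sqrt_pos.
assert (4 * a + b + 1 <= r) by nra.
assert (ln (INR k) <= 2 * r).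
{ rewrite <- Hr, ln_mult by lra.
  pose proof (exp_ineq1_le (ln r)) as Hl; rewrite exp_ln in Hl by lra; lra. }
assert (log2 (INR k) <= 4 * r).
{ unfold log2; pose proof ln_lt_2 as L2.
  apply Rmult_le_reg_r with (ln 2); [lra|].
  unfold Rdiv; rewrite Rmult_assoc, Rinv_l by lra; nra. }
nra.
Qed.

Lemma nat_ceil r : 0 <= r -> exists n : nat, r <= INR n <= r + 1.
Proof.
intros Hr; destruct (archimed r) as [H1 H2].
exists (Z.to_nat (up r)); rewrite INR_IZR_INZ, Z2Nat.id; [lra|].
apply le_IZR; lra.
Qed.

(** * Success probability of BT-steps *)

Lemma bt_prob_ge k sg :
  (sg + 1 <= k)%nat -> (2 <= k)%nat ->
  / 2 / log2 (INR k) <= / (1 + log2 (INR sg + 1)).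
Proof.
intros H Hk; apply le_INR in H, Hk; rewrite plus_INR in H; simpl in H, Hk.
pose proof (pos_INR sg); pose proof (log2_ge1 (INR k) ltac:(lra)).
pose proof (log2_le (INR sg + 1) (INR k) ltac:(lra) H).
pose proof (log2_nonneg (INR sg + 1) ltac:(lra)).
unfold Rdiv; rewrite <- Rinv_mult; apply Rinv_le_contravar; lra.
Qed.

Lemma bt_prob_le_half sg : (1 <= sg)%nat -> / (1 + log2 (INR sg + 1)) <= / 2.
Proof.
intros H; apply le_INR in H; simpl in H.
pose proof (log2_ge1 (INR sg + 1) ltac:(lra)).
apply Rinv_le_contravar; lra.
Qed.

Lemma succ_prob_ge p r n : 0 <= p -> 0 <= r -> r <= (1 - p) ^ n -> p * r <= succ_prob p n.
Proof.
intros Hp Hr H; unfold succ_prob; rewrite S_INR; pose proof (pos_INR n).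
assert (p * r <= p * (1 - p) ^ n) by (apply Rmult_le_compat_l; lra).
assert (0 <= p * (1 - p) ^ n) by (apply Rmult_le_pos; lra).
rewrite Rmult_assoc; nra.
Qed.

Lemma half_pow_antitone n K : (n <= K)%nat -> (/ 2) ^ K <= (/ 2) ^ n.
Proof.
intros H; replace K with (n + (K - n))%nat by lia; rewrite pow_add.
assert (0 <= (/ 2) ^ n) by (apply pow_le; lra).
assert ((/ 2) ^ (K - n) <= 1) by (rewrite <- (pow1 (K - n)); apply pow_incr; lra).
nra.
Qed.

(** After one delivery each of the at most [K] other nodes is silent with probability at least
    1/2. *)
Lemma bt_succ_prob_small K k n sg :
  (k <= K)%nat -> (1 <= sg)%nat -> (S n + sg = k)%nat ->
  (/ 2) ^ K / 2 / log2 (INR k) <= succ_prob (/ (1 + log2 (INR sg + 1))) n.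
Proof.
intros HK Hs Hk.
pose proof (bt_prob_ge k sg ltac:(lia) ltac:(lia)) as H1.
pose proof (bt_prob_le_half sg Hs) as H2.
pose proof (bt_prob_bounds sg) as H3.
assert (0 <= (/ 2) ^ K) by (apply pow_le; lra).
eapply Rle_trans; [|apply (succ_prob_ge _ ((/ 2) ^ K)); [lra | auto |]].
- replace ((/ 2) ^ K / 2 / log2 (INR k)) with (/ 2 / log2 (INR k) * (/ 2) ^ K)
    by (unfold Rdiv; ring).
  apply Rmult_le_compat_r; lra.
- apply Rle_trans with ((/ 2) ^ n); [apply half_pow_antitone; lia | apply pow_incr; lra].
Qed.

(** As [sg >= k / 2], the transmission probability [p] is at most [1 / log2 k], so [p * n <= a]; and
    [1 - p >= exp (- 2 p)] for [p <= 1/2] bounds the probability of silence. *)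
Lemma bt_succ_prob_large a k n sg :
  0 <= a -> (1 <= sg)%nat -> (S n + sg = k)%nat ->
  INR k / 2 <= INR sg -> INR n <= a * log2 (INR k) ->
  exp (- 2 * a) / 2 / log2 (INR k) <= succ_prob (/ (1 + log2 (INR sg + 1))) n.
Proof.
intros Ha Hs Hk Hsk Hn.
pose proof (bt_prob_ge k sg ltac:(lia) ltac:(lia)) as H1.
pose proof (bt_prob_le_half sg Hs) as H2.
pose proof (bt_prob_bounds sg) as H3.
assert (2 <= INR k) as Hk2 by (apply (le_INR 2); lia).
pose proof (log2_ge1 _ Hk2) as HL.
pose proof (exp_pos (- 2 * a)).
assert (/ (1 + log2 (INR sg + 1)) * log2 (INR k) <= 1) as H4.
{ pose proof (log2_le (INR k / 2) (INR sg + 1) ltac:(lra) ltac:(lra)) as H4.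
  rewrite log2_half in H4 by lra.
  apply Rmult_le_reg_l with (1 + log2 (INR sg + 1)); [lra|].
  rewrite <- Rmult_assoc, Rinv_r by lra; lra. }
set (p := / (1 + log2 (INR sg + 1))) in *.
eapply Rle_trans; [|apply (succ_prob_ge _ (exp (- 2 * a))); [lra | lra |]].
- replace (exp (- 2 * a) / 2 / log2 (INR k)) with (/ 2 / log2 (INR k) * exp (- 2 * a))
    by (unfold Rdiv; ring).
  apply Rmult_le_compat_r; lra.
- assert (exp (- (2 * p)) <= 1 - p) as Hp.
  { rewrite exp_Ropp; pose proof (exp_ineq1_le (2 * p)).
    apply Rle_trans with (/ (1 + 2 * p)); [apply Rinv_le_contravar; lra|].
    apply Rmult_le_reg_r with (1 + 2 * p); [lra|]; rewrite Rinv_l by lra; nra. }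
  eapply Rle_trans; [|apply (exp_le_pow _ _ n Hp)].
  apply exp_le.
  assert (p * INR n <= p * (a * log2 (INR k))) by (apply Rmult_le_compat_l; lra).
  nra.
Qed.

(** At least [(T - 1) / 2] of the remaining [T] steps are BT-steps, and [1 - u <= exp (- u)] turns
    [bt_phase] into an exponential bound. *)
Lemma drain delta k m0 q0 D :
  0 < delta -> (2 <= k)%nat -> 0 <= q0 <= 1 ->
  (forall n x, (S n < m0)%nat -> (S n + sig x = k)%nat ->
     q0 / log2 (INR k) <= succ_prob (/ (1 + log2 (INR (sig x) + 1))) n) ->
  forall T s m x, (m < m0)%nat -> (m + sig x = k)%nat -> delta + 1 <= kap x ->
  D <= INR T ->
  fail delta T s m x <= exp (INR m0 - q0 * (D - 1) / (4 * log2 (INR k))).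
Proof.
intros Hd Hk Hq Hbt T s m x Hm Hmk Hx HD.
assert (2 <= INR k) as Hk2 by (apply (le_INR 2); lia).
pose proof (log2_ge1 _ Hk2) as HL.
pose proof (inv_bounds _ HL) as HiL.
set (qs := q0 / log2 (INR k)) in *.
assert (0 <= qs <= 1) as Hqs by (unfold qs, Rdiv; nra).
eapply Rle_trans; [apply (bt_phase delta k m0 qs Hd Hqs Hbt); auto|].
set (N := Nat.div2 _).
assert ((INR T - 1) / 2 <= INR N) as HN.
{ assert (T <= 2 * N + 1)%nat as H.
  { unfold N; destruct (Nat.even s).
    - pose proof (Nat.div2_odd (S T)); destruct (Nat.odd (S T)); simpl Nat.b2n in *; lia.
    - pose proof (Nat.div2_odd T); destruct (Nat.odd T); simpl Nat.b2n in *; lia. }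
  apply le_INR in H; rewrite plus_INR, mult_INR in H; simpl in H; lra. }
assert ((1 - qs / 2) ^ N <= exp (INR N * - (qs / 2))) as HP.
{ rewrite exp_INR_mult; pose proof (exp_ineq1_le (- (qs / 2))); apply pow_incr; lra. }
eapply Rle_trans; [apply Rmult_le_compat_l; [left; apply exp_pos | exact HP]|].
rewrite <- exp_plus; apply exp_le.
apply lt_INR in Hm.
replace (q0 * (D - 1) / (4 * log2 (INR k))) with (qs / 2 * ((D - 1) / 2))
  by (unfold qs; field; lra).
assert (qs / 2 * ((D - 1) / 2) <= qs / 2 * INR N) by (apply Rmult_le_compat_l; lra).
lra.
Qed.

(** * The two ranges of [k] *)

(** Here the first phase lasts until the first delivery. Before it an AT-step succeeds with
    probability at least [c / kap], which makes the power [kap ^ c], set to 0 at the delivery, a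
    supermartingale. *)
Lemma small_case delta K :
  1 < delta -> exists C0, 0 < C0 /\ forall C, C0 <= C ->
  forall k T : nat, (2 <= k)%nat -> (k <= K)%nat ->
  2 * (delta + 1) * INR k + C * log2 (INR k) ^ 2 < INR T + 1 ->
  fail delta T 1 k (init_state delta) <= 2 / (1 + INR k).
Proof.
intros Hd.
remember ((/ 2) ^ K) as c eqn:Ec.
assert (0 < c <= 1) as Hc.
{ rewrite Ec; split; [apply pow_lt; lra | rewrite <- (pow1 K); apply pow_incr; lra]. }
(* The value of [kap] at which the potential [V] below reaches 1. *)
set (K1 := (delta + 1) * exp (INR K / c)).
assert (0 < K1) as HK1 by (apply Rmult_lt_0_compat; [lra | apply exp_pos]).
pose proof (pos_INR K) as HK0.
assert (0 <= 2 * INR K / (c / 8)) as Hq.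
{ apply Rmult_le_pos; [lra | left; apply Rinv_0_lt_compat; lra]. }
(* [2 * K1 + 2] pays for the first phase and rounding; the rest lowers the exponent of [E] by
   [2 * K], half of it to offset [INR k]. *)
exists (2 + 2 * K1 + 2 * INR K / (c / 8)); split; [lra|].
intros C HC k T Hk HkK HT.
assert (2 <= INR k) as Hk2 by (apply (le_INR 2); lia).
pose proof (le_INR _ _ HkK) as HkK'.
pose proof (log2_ge1 _ Hk2) as HL.
set (L := log2 (INR k)) in *.
set (V := fun (s m : nat) (y : R) =>
  if Nat.ltb m k then 0 else exp (c * (ln y - ln (delta + 1)) - INR K)).
set (E := exp (INR k - (c / 2) * (C * L ^ 2 - 2 * K1 - 1 - 1) / (4 * L))).
assert (0 <= 2 * (delta + 1) * INR k) as Hdk by nra.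
assert (1 <= L ^ 2) as HL2 by (simpl; nra).
assert (0 < C) as HC0' by lra.
assert (C <= C * L ^ 2) as HCL by nra.
assert (fail delta T 1 k (init_state delta) <= V 1%nat k (kap (init_state delta)) + E) as H.
{ apply (potential_bound delta k k T (2 * K1) E V); try lia; try (unfold E; left; apply exp_pos).
  - lra.
  - lra.
  - intros s m y; unfold V; destruct (Nat.ltb m k); [lra | left; apply exp_pos].
  - intros T' s m x Hm Hmk Hx Hs Hs'.
    apply (drain delta k k (c / 2)); auto; try lra.
    + intros n x' H1 H2; rewrite Ec; apply bt_succ_prob_small; lia.
    + apply (f_equal INR) in Hs; rewrite !plus_INR in Hs; simpl in Hs; lra.
  - intros s n x Hn Hnk Hx Hclk.
    assert (S n = k) as Ek by lia.
    assert (sig x = 0%nat) as Es by lia.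
    unfold V; rewrite Ek, Nat.ltb_irrefl.
    replace (Nat.ltb n k) with true by (symmetry; apply Nat.ltb_lt; lia).
    destruct (Rle_lt_dec K1 (kap x)) as [Hlarge|Hsmall]; [left|right].
    + apply ln_le in Hlarge; [|lra].
      unfold K1 in Hlarge; rewrite ln_mult, ln_exp in Hlarge by (try apply exp_pos; lra).
      apply Rle_trans with (exp 0); [rewrite exp_0; lra | apply exp_le].
      assert (c * (INR K / c) <= c * (ln (kap x) - ln (delta + 1)))
        by (apply Rmult_le_compat_l; lra).
      assert (c * (INR K / c) = INR K) by (field; lra); lra.
    (* With [sig = 0] the clock gives [s <= 2 * kap < 2 * K1]. *)
    + unfold clock in Hclk; rewrite Es in Hclk; simpl in Hclk.
      split; [destruct (Nat.even s); lra|].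
      pose proof (tprob_bounds delta s x ltac:(lra) Hx) as Hp.
      pose proof (succ_prob_nonneg _ n Hp) as Q0; pose proof (succ_prob_le1 _ n Hp) as Q1.
      rewrite Rmult_0_r, Rplus_0_l.
      unfold tprob, post in *; destruct (Nat.even s).
      { set (q := succ_prob _ n) in *; set (w := exp _).
        assert (0 < w) by apply exp_pos; nra. }
      simpl kap.
      (* [(1 + 1/y)^c <= exp (c/y) <= 1 / (1 - c/y)] and the success probability is at least [c/y] *)
      set (y := kap x) in *.
      assert (0 < / y <= / 2) as Hy.
      { split; [apply Rinv_0_lt_compat; lra | apply Rinv_le_contravar; lra]. }
      assert (/ y * c <= succ_prob (/ y) n) as Hqc.
      { apply succ_prob_ge; [lra | lra|]; rewrite Ec.
        apply Rle_trans with ((/ 2) ^ n); [apply half_pow_antitone; lia | apply pow_incr; lra]. }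
      assert (ln (y + 1) <= ln y + / y) as Hln.
      { replace (y + 1) with (y * (1 + / y)) by (field; lra).
        rewrite ln_mult by lra.
        pose proof (exp_ineq1_le (/ y)) as He.
        apply ln_le in He; [|lra]; rewrite ln_exp in He; lra. }
      apply Rle_trans with (exp (- (/ y * c)) * exp (c * (ln (y + 1) - ln (delta + 1)) - INR K)).
      * apply Rmult_le_compat_r; [left; apply exp_pos|].
        pose proof (exp_ineq1_le (- (/ y * c))); lra.
      * rewrite <- exp_plus; apply exp_le; nra.
  - apply Nat.add_0_r.
  - simpl; lra.
  - unfold clock; simpl; lra. }
assert (V 1%nat k (kap (init_state delta)) = exp (- INR K)) as HV.
{ unfold V; rewrite Nat.ltb_irrefl; f_equal; simpl; ring. }
assert (E <= exp (- INR K)) as HE.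
{ unfold E; apply exp_le.
  assert (2 * INR K <= c / 2 * (C * L ^ 2 - 2 * K1 - 1 - 1) / (4 * L)); [|lra].
  assert (2 * INR K / (c / 8) * (c / 8) = 2 * INR K) as Hcancel by (field; lra).
  assert (2 * INR K <= c / 8 * (C - 2 * K1 - 2)) as H1 by nra.
  apply Rmult_le_reg_r with (4 * L); [lra|].
  replace (c / 2 * (C * L ^ 2 - 2 * K1 - 1 - 1) / (4 * L) * (4 * L))
    with (c / 2 * (C * L ^ 2 - 2 * K1 - 2)) by (field; lra).
  assert (2 * INR K * (4 * L) <= c / 8 * (C - 2 * K1 - 2) * (4 * L)) by (apply Rmult_le_compat_r; lra).
  assert (0 <= C - 2 * K1 - 2) by lra.
  assert ((C - 2 * K1 - 2) * L <= C * L ^ 2 - 2 * K1 - 2).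
  { assert (0 <= (C - 2 * K1 - 2) * (L * L - L)) by (apply Rmult_le_pos; nra).
    assert ((2 * K1 + 2) * (L * L) >= 2 * K1 + 2) by nra.
    simpl; nra. }
  apply Rle_trans with (c / 2 * ((C - 2 * K1 - 2) * L)); [lra|].
  apply Rmult_le_compat_l; lra. }
assert (exp (- INR K) <= / (1 + INR k)).
{ rewrite exp_Ropp; apply Rinv_le_contravar; [lra|].
  pose proof (exp_ineq1_le (INR K)); lra. }
unfold Rdiv; lra.
Qed.

(* Makes the threshold [m0 >= logfactor * log2 k] large enough for [k * exp (- rate * m0 / 20)]
   to be polynomially small in [k]. *)
Definition logfactor : R := 400000.

(** The initial potential, the accumulated drift errors and the draining phase each contribute at
    most [k ^ (-3)]. *)
Lemma large_case delta K :
  27/10 <= delta <= 3 ->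
  (forall k, (K <= k)%nat -> 2 * logfactor * log2 (INR k) + 2 <= INR k) ->
  exists C0, 0 < C0 /\ forall C, C0 <= C ->
  forall k T : nat, (2 <= k)%nat -> (K <= k)%nat ->
  2 * (delta + 1) * INR k + C * log2 (INR k) ^ 2 < INR T + 1 ->
  fail delta T 1 k (init_state delta) <= 2 / (1 + INR k).
Proof.
intros Hd HK.
set (q0 := exp (- 2 * logfactor) / 2).
assert (0 < q0 <= 1) as Hq0.
{ unfold q0; pose proof (exp_pos (- 2 * logfactor)).
  assert (exp (- 2 * logfactor) <= exp 0) as H0 by (apply exp_le; unfold logfactor; lra).
  rewrite exp_0 in H0; lra. }
set (A := logfactor) in *.
assert (0 < (A + 5) * 4 / q0) as HC0.
{ unfold Rdiv; apply Rmult_lt_0_compat; [unfold A, logfactor; lra | apply Rinv_0_lt_compat; lra]. }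
(* Lowers the exponent of [E] by about [(A + 5) * L]: [A * L] offsets [m0], [3 * L] yields
   [k ^ (-3)], and [2 * L] absorbs rounding. *)
exists ((A + 5) * 4 / q0); split; [auto|].
intros C HC k T Hk HkK HT.
specialize (HK k HkK).
assert (2 <= INR k) as Hk2 by (apply (le_INR 2); lia).
pose proof (log2_ge1 _ Hk2) as HL.
pose proof (ln_le_log2 (INR k) ltac:(lra)) as Hln.
set (L := log2 (INR k)) in *.
destruct (nat_ceil (A * L)) as [m0 Hm0]; [unfold A, logfactor; lra|].
set (S0 := 2 * (delta + 1) * INR k).
set (b := exp (rate * (2 - INR m0 / 20))).
assert (0 < b) as Hb by apply exp_pos.
(* The second term prepays the additive error [b] for every step up to [S0]. *)
set (V := fun (s m : nat) (y : R) =>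
  exp (rate * (y - 4/5 * INR m)) + b * Rmax 0 (S0 + 1 - INR s)).
set (E := exp (INR m0 - q0 * (C * L ^ 2 - 1 - 1) / (4 * L))).
assert (140 <= INR m0) as Hm140 by (unfold A, logfactor in *; lra).
assert (1 <= L ^ 2) as HL2 by (simpl; nra).
assert (0 < C) as HC0' by lra.
assert (C <= C * L ^ 2) as HCL by nra.
assert (m0 <= k)%nat as Hm0k.
{ apply INR_le; unfold A, logfactor in *; lra. }
assert (fail delta T 1 k (init_state delta) <= V 1%nat k (kap (init_state delta)) + E) as H1.
{ apply (potential_bound delta k m0 T S0 E V); auto; try lia; try (unfold E; left; apply exp_pos).
  - lra.
  - apply INR_lt; simpl; lra.
  - unfold S0; lra.
  - intros s m y; unfold V.
    pose proof (exp_pos (rate * (y - 4/5 * INR m))).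
    pose proof (Rmax_l 0 (S0 + 1 - INR s)); nra.
  - intros T' s m x Hm Hmk Hx Hs Hs'.
    apply (drain delta k m0 q0 (C * L ^ 2 - 1)); auto; try lra.
    (* Fewer than [m0] nodes remain, so [HK] leaves at least [k / 2] deliveries made. *)
    + intros n x' H1 H2.
      pose proof (le_INR _ _ H1) as H3; rewrite !S_INR in H3.
      pose proof (f_equal INR H2) as H4; rewrite plus_INR, S_INR in H4.
      apply bt_succ_prob_large; auto; fold L; unfold A, logfactor in *; try lra.
      apply INR_le; simpl; lra.
    + apply (f_equal INR) in Hs; rewrite !plus_INR in Hs; simpl in Hs; unfold S0 in *; lra.
  - intros s n x Hn Hnk Hx Hclk.
    destruct (Rle_lt_dec (4/5 * INR (S n)) (kap x)) as [Hlarge|Hsmall]; [left|right].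
    + unfold V; pose proof (Rmax_l 0 (S0 + 1 - INR s)).
      assert (exp 0 <= exp (rate * (kap x - 4/5 * INR (S n)))) as H2
        by (apply exp_le; unfold rate; lra).
      rewrite exp_0 in H2; nra.
    (* As [kap < 4/5 m <= (delta + 1) m], the clock yields [s <= 2 (delta + 1) (m + sig) = S0]. *)
    + assert (INR s <= S0) as Hs.
      { unfold clock in Hclk.
        apply (f_equal INR) in Hnk; rewrite plus_INR in Hnk.
        assert (INR s <= 2 * (kap x + (delta + 1) * INR (sig x)))
          by (destruct (Nat.even s); lra).
        pose proof (pos_INR (S n)); unfold S0; rewrite <- Hnk; nra. }
      split; [exact Hs|]; unfold V.
      pose proof (potential_drift delta s n x m0 Hd Hx Hm140 Hn ltac:(lra)) as Hdrift.
      rewrite (S_INR s), !Rmax_right by lra.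
      fold b in Hdrift; set (q := succ_prob _ n) in *; lra.
  - simpl; lra.
  - unfold clock; simpl; lra. }
assert (E <= exp (- (3 * ln (INR k)))) as HE.
{ unfold E; apply exp_le.
  assert ((A + 5) * L <= q0 * (C * L ^ 2 - 1 - 1) / (4 * L) + 1); [|unfold A, logfactor in *; lra].
  apply Rmult_le_reg_r with (4 * L); [lra|].
  replace ((q0 * (C * L ^ 2 - 1 - 1) / (4 * L) + 1) * (4 * L))
    with (q0 * (C * L ^ 2 - 2) + 4 * L) by (field; lra).
  assert ((A + 5) * 4 / q0 * q0 = (A + 5) * 4) by (field; lra).
  assert ((A + 5) * 4 <= q0 * C) by nra.
  assert ((A + 5) * 4 * L ^ 2 <= q0 * C * L ^ 2) by (apply Rmult_le_compat_r; [apply pow_le; lra | lra]).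
  simpl in *; nra. }
assert (exp (rate * (delta + 1 - 4/5 * INR k)) <= exp (- (3 * ln (INR k)))) as HV1
  by (apply exp_le; unfold rate, A, logfactor in *; lra).
assert (b * S0 <= exp (- (3 * ln (INR k)))) as HV2.
(* [2 (delta + 1) <= 8 <= exp (7 L)] and [k <= exp L], while [b <= exp (1 - 20 L)]. *)
{ apply Rle_trans with (b * exp (7 * L + L)).
  - apply Rmult_le_compat_l; [lra|]; unfold S0.
    rewrite exp_plus.
    assert (INR k <= exp L) by (rewrite <- (exp_ln (INR k)) at 1 by lra; apply exp_le; lra).
    pose proof (exp_ineq1_le (7 * L)).
    apply Rmult_le_compat; lra.
  - unfold b; rewrite <- exp_plus; apply exp_le; unfold rate, A, logfactor in *; lra. }
assert (V 1%nat k (kap (init_state delta)) <= 2 * exp (- (3 * ln (INR k)))) as HV.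
{ unfold V; simpl INR; simpl kap; rewrite Rmax_right by (unfold S0; nra).
  replace (S0 + 1 - 1) with S0 by ring; lra. }
assert (3 * exp (- (3 * ln (INR k))) <= 2 / (1 + INR k)); [|lra].
replace (- (3 * ln (INR k))) with (INR 3 * - ln (INR k)) by (simpl; ring).
rewrite exp_INR_mult, exp_Ropp, exp_ln, pow_inv by lra.
assert (0 < INR k ^ 3) by (apply pow_lt; lra).
apply Rmult_le_reg_r with (INR k ^ 3); [lra|].
rewrite Rmult_assoc, Rinv_l by lra.
apply Rmult_le_reg_r with (1 + INR k); [lra|].
replace (2 / (1 + INR k) * INR k ^ 3 * (1 + INR k)) with (2 * INR k ^ 3) by (field; lra).
assert (4 * INR k <= INR k ^ 3) by (simpl; nra).
lra.
Qed.

Theorem mainTheorem1 (delta : R)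
  (Hd1 : exp 1 < delta)
  (Hd2 : delta <= 5/6 + (5/6)^2 + (5/6)^3 + (5/6)^4 + (5/6)^5) :
  exists C : R, 0 < C /\
    forall (k T : nat), (2 <= k)%nat ->
      INR T <= 2 * (delta + 1) * INR k + C * (log2 (INR k))^2 < INR T + 1 ->
      success_prob delta k T >= 1 - 2 / (1 + INR k).
Proof.
pose proof exp_1_ge.
(* The sum of powers of 5/6 is about 2.99. *)
assert (27/10 <= delta <= 3) as Hd by lra.
destruct (log2_sublinear (2 * logfactor) 2 ltac:(unfold logfactor; lra) ltac:(lra)) as [K HK].
destruct (small_case delta K ltac:(lra)) as [C1 [HC1 Hsmall]].
destruct (large_case delta K Hd HK) as [C2 [HC2 Hlarge]].
exists (C1 + C2); split; [lra|].
intros k T Hk [_ HT].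
enough (fail delta T 1 k (init_state delta) <= 2 / (1 + INR k)) as H0
  by (unfold fail in H0; unfold success_prob; lra).
destruct (Nat.le_ge_cases k K).
- apply (Hsmall (C1 + C2)); auto; lra.
- apply (Hlarge (C1 + C2)); auto; lra.
Qed.
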